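(* Let $p$ be a prime, let $G$ be a finite group, let $P$ be a Sylow $p$-subgroup of $G$, and let $B$ be a $p$-block of $G$ with defect group $P$. Let $N$ be a normal subgroup of $G$ such that $PN/N>1$, and let $\theta\in\mathrm{Irr}(N)$. Let $k_0(B|\theta)$ be the number of irreducible complex characters of $G$ of degree coprime to $p$ that belong to $B$ and lie above $\theta$. Then either $k_0(B|\theta)=0$ or $k_0(B|\theta)\geq 2$. If moreover $p\leq 3$, then $k_0(B|\theta)$ is divisible by $p$.
   Context: $\mathrm{Irr}(N)$ is the set of irreducible complex characters of $N$. A character $\chi\in\mathrm{Irr}(G)$ lies above $\theta\in\mathrm{Irr}(N)$ if $\theta$ is a constituent of the restriction $\chi_N$. *)

(* Defs.v *)
From mathcomp Require Import all_boot all_order all_fingroup all_algebra.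
From mathcomp Require Import all_solvable all_field all_character.

Set Implicit Arguments.
Unset Strict Implicit.
Unset Printing Implicit Defensive.

Import GroupScope Order.TTheory GRing.Theory Num.Theory.
Local Open Scope ring_scope.

(* Closure under opposites follows from -1 \in Aint. *)
Definition Aint_ideal (I : algC -> Prop) : Prop :=
  [/\ forall x, I x -> x \in Aint,
      I 0,
      forall x y, I x -> I y -> I (x + y)
    & forall a x, a \in Aint -> I x -> I (a * x)].

Definition maximal_Aint_ideal (M : {pred algC}) : Prop :=
  [/\ Aint_ideal (fun x => x \in M),
      1 \notin M
    & forall J : algC -> Prop, Aint_ideal J -> ~ J 1 ->
        (forall x, x \in M -> J x) -> forall x, J x -> x \in M].

(* The maximal ideal of the localization of Aint at M, that is, the kernel of *)
(* the extension of the residue map Aint -> Aint / M to this localization.    *)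
Definition localized_ideal (M : {pred algC}) (a : algC) : Prop :=
  exists r s, [/\ r \in M, s \in Aint, s \notin M & a = r / s].

Section Blocks.

Variables (gT : finGroupType) (G : {group gT}).

(* The central characters of 'chi_i and 'chi_j agree modulo M.                *)
Definition same_block (M : {pred algC}) : rel (Iirr G) :=
  fun i j => [forall k : 'I_#|classes G|, 'omega_i['K_k] - 'omega_j['K_k] \in M].

(* A p-block is identified with the set of (indices of) its irreducible       *)
(* complex characters; M is a maximal ideal of Aint that contains p.          *)
Definition blocks (M : {pred algC}) : {set {set Iirr G}} :=
  equivalence_partition (same_block M) setT.

(* The coefficient at x of \sum_(i in B) e_i, where the primitive central     *)
(* idempotent of the complex group algebra attached to 'chi_i is              *)
(*   e_i = #|G|^-1 * 'chi_i 1 * \sum_(x in G) 'chi_i x^-1 *: x.               *)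
(* When B is a block, this lies in the localization of Aint at M (Osima).     *)
Definition block_idem_coef (B : {set Iirr G}) (x : gT) : algC :=
  #|G|%:R^-1 * \sum_(i in B) 'chi_i 1%g * 'chi_i x^-1%g.

(* A defect class of B is a class whose sum is not killed by the central      *)
(* character of B modulo M, and which occurs with nonzero coefficient in the  *)
(* block idempotent modulo M. The defect groups of B are those of any of its  *)
(* defect classes, i.e., the Sylow p-subgroups of centralizers of elements.   *)
Definition block_defect_group (p : nat) (M : {pred algC}) (B : {set Iirr G})
    (D : {group gT}) : Prop :=
  exists (k : 'I_#|classes G|) (x : gT),
    [/\ x \in enum_val k,
        exists2 i, i \in B & 'omega_i['K_k] \notin M,
        ~ localized_ideal M (block_idem_coef B x)
      & p.-Sylow('C_G[x]) D].

Definition k0_above (p : nat) (B : {set Iirr G}) (N : {group gT}) (t : Iirr N) :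
    nat :=
  #|[set i in B | coprime p (Num.truncn ('chi_i 1%g))
                  & t \in irr_constt ('Res[N] 'chi_i)]|.

End Blocks.

(* Main.v *)
(* Put e_i = '['Res 'chi_i, 'chi_t] and suppose that some character in B above *)
(* 'chi_t has degree prime to p. If T is the stabilizer of 'chi_t then, by     *)
(* Clifford, p does not divide |G : T| 'chi_t(1), and 'chi_i has degree prime  *)
(* to p and lies above 'chi_t iff p does not divide e_i. As p divides |G : N|, *)
(* it divides |T : N|, so that all values of phi = 'Ind[G] 'chi_t lie in       *)
(* p Aint. For z in the center of Aint[G], the sum over all i of               *)
(* omega_i(z) e_i 'chi_i(1) is phi(z), which is thus in M. Taking z that acts  *)
(* as 0 on the other blocks and as a nonzero constant mod M on B, we get       *)
(* p | \sum_(i in B) e_i 'chi_i(1) = |G : T| 'chi_t(1) \sum_(i in B) e_i^2,    *)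
(* so the sum of the e_i^2 prime to p is 0 mod p. Hence there is not exactly   *)
(* one of them, and if p <= 3 then each of them is 1 mod p.                    *)
Require Import Defs.
From mathcomp Require Import all_boot all_order all_fingroup all_algebra.
From mathcomp Require Import all_solvable all_field all_character.

Import Order.TTheory GRing.Theory Num.Theory.

(** A congruence modulo [M] is read back in the integers. [cfInd_max_ideal] puts the values of the
    induced character in [M], and [block_degree_in] passes this to the degree of its [B]-part. By
    Clifford ([ramification_irr1]) that degree is a prime-to-[p] multiple of the sum of the squared
    ramification indices over [B]; [max_ideal_nat] makes the membership a divisibility by [p], and
    [dvdn_sum_sqr_card] counts. *)

Section RelativeHeightZero.

Local Open Scope ring_scope.
Set Implicit Arguments.
Unset Strict Implicit.
Unset Printing Implicit Defensive.

(** * Congruences modulo a maximal ideal of the algebraic integers *)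

Section MaximalIdeal.

Variable M : {pred algC}.
Hypothesis maxM : maximal_Aint_ideal M.

Lemma max_ideal_sum (I : Type) (r : seq I) (Q : pred I) (F : I -> algC) :
  (forall i, Q i -> F i \in M) -> \sum_(i <- r | Q i) F i \in M.
Proof. by have [[_ M0 MD _] _ _] := maxM; apply: (big_ind (fun x => x \in M)). Qed.

Lemma max_idealN x : x \in M -> - x \in M.
Proof.
by have [[_ _ _ MM] _ _] := maxM => Mx; rewrite -mulN1r MM // rpredN Aint1.
Qed.

(** If [b] is not in [M], then [M + Aint a] is proper, since [1 = m + r a] would give
    [b = b m + r (a b)] in [M]; maximality then puts [a] in [M]. *)
Lemma max_ideal_prime a b :
  a \in Aint -> b \in Aint -> a * b \in M -> a \notin M -> b \in M.
Proof.
have [[MA M0 MD MM] M1 maxI] := maxM => Aa Ab Mab; apply: contraNT => notMb.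
pose J x := exists m r, [/\ m \in M, r \in Aint & x = m + r * a].
apply: (maxI J); first 1 last.
- move=> [m [r [Mm Ar J1]]]; case/negP: notMb.
  rewrite -[b]mulr1 J1 mulrDr mulrCA [b * a]mulrC.
  by apply: MD; apply: MM.
- by move=> x Mx; exists x, 0; rewrite mul0r addr0 Mx Aint0.
- by exists 0, 1; rewrite mul1r add0r M0 Aint1.
split.
- by move=> _ [m [r [Mm Ar ->]]]; apply: rpredD; [apply: MA | apply: rpredM].
- by exists 0, 0; rewrite mul0r addr0 M0 Aint0.
- move=> _ _ [m [r [Mm Ar ->]]] [m1 [r1 [Mm1 Ar1 ->]]].
  by exists (m + m1), (r + r1); rewrite MD ?rpredD // mulrDl addrACA.
move=> c _ Ac [m [r [Mm Ar ->]]].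
by exists (c * m), (c * r); rewrite MM ?rpredM // mulrDr mulrA.
Qed.

Lemma max_ideal_prod_notin (I : Type) (r : seq I) (Q : pred I) (F : I -> algC) :
    (forall i, Q i -> F i \in Aint) -> (forall i, Q i -> F i \notin M) ->
  \prod_(i <- r | Q i) F i \notin M.
Proof.
move=> AF MF; pose R x := (x \in Aint) && (x \notin M).
suffices /andP[]: R (\prod_(i <- r | Q i) F i) by [].
have [_ M1 _] := maxM; apply: (big_ind R) => [|x y /andP[Ax Mx] /andP[Ay My]|i Qi].
- by rewrite /R Aint1.
- by rewrite /R rpredM //=; apply: contra My => /max_ideal_prime->.
- by rewrite /R AF // MF.
Qed.

Lemma max_ideal_prod_cong (I : Type) (r : seq I) (Q : pred I) (F F' : I -> algC) :
    (forall i, Q i -> F i \in Aint) -> (forall i, Q i -> F' i \in Aint) ->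
    (forall i, Q i -> F i - F' i \in M) ->
  \prod_(i <- r | Q i) F i - \prod_(i <- r | Q i) F' i \in M.
Proof.
have [[MA M0 MD MM] _ _] := maxM => AF AF' MF.
pose R x y := [&& x \in Aint, y \in Aint & x - y \in M].
suffices /and3P[]: R (\prod_(i <- r | Q i) F i) (\prod_(i <- r | Q i) F' i) by [].
apply: (big_ind2 R) => [|x x' y y' /and3P[Ax Ax' Mx] /and3P[Ay Ay' My]|i Qi].
- by rewrite /R Aint1 subrr.
- apply/and3P; split; rewrite ?rpredM //.
  rewrite -(subrK (x * y') (x * y)) -addrA -mulrBr -mulrBl [_ * y']mulrC.
  by apply: MD; apply: MM.
- by rewrite /R AF ?AF' ?MF.
Qed.

Lemma max_ideal_nat (p n : nat) :
  prime p -> p%:R \in M -> (n%:R \in M) = (p %| n)%N.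
Proof.
have [[MA M0 MD MM] M1 _] := maxM => p_pr Mp.
have Anat m : (m%:R : algC) \in Aint by rewrite rpred_nat.
apply/idP/idP=> [Mn | /dvdnP[q ->]]; last by rewrite natrM MM.
apply: contraNT M1; rewrite -prime_coprime // => co_pn.
have [u _ /dvdnP[v]] := Bezoutl n (prime_gt0 p_pr).
rewrite (eqP co_pn) => Duv.
have ->: 1 = v%:R * p%:R - u%:R * n%:R :> algC.
  by rewrite -!natrM -Duv natrD addrK.
by apply: MD; last apply: max_idealN; apply: MM.
Qed.

End MaximalIdeal.

(** * Central characters and the block projection *)

Section ClassSums.

Variables (gT : finGroupType) (G : {group gT}).

Lemma gring_mode_classM (i : Iirr G) (j k : 'I_#|classes G|) :
  'omega_i['K_j] * 'omega_i['K_k] =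
    \sum_l (gring_classM_coef j k l)%:R * 'omega_i['K_l].
Proof.
rewrite -gring_irr_modeM ?gring_class_sum_central // gring_classM_expansion.
rewrite raddf_sum; apply: eq_bigr => l _.
by rewrite scaler_nat raddfMn mulr_natl.
Qed.

(* The functions i |-> 'omega_i[z] with z in the center of Aint[G]. *)
Definition integral_mode (f : Iirr G -> algC) : Prop :=
  exists2 c : 'I_#|classes G| -> algC, forall k, c k \in Aint
    & forall i, f i = \sum_k c k * 'omega_i['K_k].

Lemma integral_mode1 : integral_mode (fun=> 1).
Proof.
pose k1 := enum_rank_in (classes1 G) 1%g.
exists (fun k => (k == k1)%:R) => [k|i]; first by rewrite rpred_nat.
rewrite (bigD1 k1) //= eqxx mul1r big1 ?addr0 => [|k /negPf->]; last first.
  by rewrite mul0r.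
rewrite (@gring_mode_class_sum_eq _ _ _ _ 1%g) ?enum_rankK_in ?classes1 //.
by rewrite mulfK ?irr1_neq0 // class1G cards1.
Qed.

(** Class sums multiply with natural structure constants, so the coefficients stay algebraic
    integers. *)
Lemma integral_mode_mulB f (j : 'I_#|classes G|) b :
    b \in Aint -> integral_mode f ->
  integral_mode (fun i => ('omega_i['K_j] - b) * f i).
Proof.
move=> Ab [c Ac Df].
exists (fun l => \sum_k c k * (gring_classM_coef j k l)%:R - b * c l) => [l|i].
  rewrite rpredB ?rpredM // rpred_sum // => k _.
  by rewrite rpredM // rpred_nat.
under eq_bigr do rewrite mulrBl mulr_suml.
rewrite sumrB exchange_big /= Df mulrBl !mulr_sumr; congr (_ - _).
  apply: eq_bigr => k _; rewrite mulrCA gring_mode_classM mulr_sumr.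
  by apply: eq_bigr => l _; rewrite mulrA.
by apply: eq_bigr => k _; rewrite mulrA.
Qed.

Lemma integral_mode_prod (I : Type) (r : seq I) (Q : pred I)
    (k : I -> 'I_#|classes G|) (b : I -> algC) :
    (forall j, b j \in Aint) ->
  integral_mode (fun i => \prod_(j <- r | Q j) ('omega_i['K_(k j)] - b j)).
Proof.
move=> Ab; elim: r => [|j r IHr].
  have [c Ac Dc] := integral_mode1.
  by exists c => // i; rewrite big_nil (Dc i).
case Qj: (Q j); last first.
  by have [c Ac Dc] := IHr; exists c => // i; rewrite big_cons Qj Dc.
have [c Ac Dc] := integral_mode_mulB (k j) (Ab j) IHr.
by exists c => // i; rewrite big_cons Qj Dc.
Qed.

Variable M : {pred algC}.
Hypothesis maxM : maximal_Aint_ideal M.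

(* When f i = 'omega_i[z], the sum below is phi evaluated at z. *)
Lemma integral_mode_sum_in f (phi : 'CF(G)) :
    integral_mode f -> (forall x, phi x \in M) ->
  \sum_i f i * ('[phi, 'chi_i] * 'chi_i 1%g) \in M.
Proof.
have [[MA M0 MD MM] _ _] := maxM => [[c Ac Df]] Mphi.
under eq_bigr do rewrite Df mulr_suml.
rewrite exchange_big (max_ideal_sum maxM) //= => k _.
have /imsetP[x Gx Dk] := enum_valP k.
have k_x: x \in enum_val k by rewrite Dk class_refl.
suffices ->: \sum_i c k * 'omega_i['K_k] * ('[phi, 'chi_i] * 'chi_i 1%g)
  = c k * #|(x ^: G)%g|%:R * phi x.
  by rewrite MM ?rpredM ?rpred_nat.
rewrite {2}[phi]cfun_sum_cfdot sum_cfunE mulr_sumr.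
apply: eq_bigr => i _; rewrite (gring_mode_class_sum_eq _ k_x) cfunE.
move: '[_, _] => e; rewrite -!mulrA; do 2!congr (_ * _).
by rewrite [_^-1 * _]mulrC mulfK ?irr1_neq0 // mulrC.
Qed.

(* Multiplying by the factors 'omega_i['K_k] - 'omega_j['K_k] for j outside B *)
(* kills the other blocks exactly and is a nonzero constant mod M on B.       *)
Lemma block_degree_in (B : {set Iirr G}) (phi : 'CF(G)) :
    B \in blocks G M -> phi \is a character -> (forall x, phi x \in M) ->
  \sum_(i in B) '[phi, 'chi_i] * 'chi_i 1%g \in M.
Proof.
have [[MA M0 MD MM] _ _] := maxM.
case/imsetP=> i0 _ DB Nphi Mphi.
have Aw i k: 'omega_i['K_k] \in Aint := @Aint_gring_mode_class_sum _ G i k.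
have inB i: (i \in B) = same_block M i0 i by rewrite DB !inE.
have /fin_all_exists[k Dk] j: exists k : 'I_#|classes G|,
    (j \notin B) ==> ('omega_i0['K_k] - 'omega_j['K_k] \notin M).
  have [_|] := boolP (j \in B); first by exists (enum_rank_in (classes1 G) 1%g).
  by rewrite inB negb_forall => /existsP[k Mk]; exists k.
pose f i := \prod_(j | j \notin B) ('omega_i['K_(k j)] - 'omega_j['K_(k j)]).
have Mf: f i0 \notin M.
  apply: (max_ideal_prod_notin maxM) => j Bj; first by rewrite rpredB.
  by have:= Dk j; rewrite Bj.
have Af: f i0 \in Aint by apply: rpred_prod => j _; rewrite rpredB.
have Ae i: '[phi, 'chi_i] * 'chi_i 1%g \in Aint.
  by rewrite rpredM ?Aint_irr // Aint_Cnat ?Cnat_cfdot_char_irr.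
(* As [f i0] is outside the prime ideal [M], it can be cancelled. *)
apply: (max_ideal_prime maxM Af) Mf; first exact: rpred_sum.
have: \sum_i f i * ('[phi, 'chi_i] * 'chi_i 1%g) \in M.
  by apply: integral_mode_sum_in => //; apply: integral_mode_prod.
rewrite (bigID (mem B)) /= addrC big1 ?add0r => [|i Bi]; last first.
  by rewrite /f (bigD1 i) //= subrr !mul0r.
move=> MfB; rewrite -(subrK (\sum_(i in B) f i * ('[phi, 'chi_i] * 'chi_i 1%g))
  (f i0 * _)) MD //.
rewrite mulr_sumr -sumrB (max_ideal_sum maxM) // => i.
rewrite inB => /forallP Mi; rewrite -mulrBl mulrC MM //.
apply: (max_ideal_prod_cong maxM) => j _; try by rewrite rpredB.
by rewrite opprB subrKA.
Qed.

End ClassSums.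

(** * Clifford theory for the induced character *)

Section Induced.

Variables (gT : finGroupType) (G N : {group gT}) (t : Iirr N).
Hypothesis nsNG : (N <| G)%g.


Definition ramification (i : Iirr G) : nat :=
  Num.truncn '['Ind[G] 'chi_t, 'chi_i].

Local Notation e := ramification.
Local Notation n := (size ('chi_t ^: G)%CF).

Lemma ramificationE i : '['Ind[G] 'chi_t, 'chi_i] = (e i)%:R.
Proof. by rewrite truncnK // Cnat_cfdot_char_irr // cfInd_char ?irr_char. Qed.

Lemma cfdot_Res_ramification i : '['Res[N] 'chi[G]_i, 'chi_t] = (e i)%:R.
Proof.
rewrite cfdotC_char ?cfRes_char ?irr_char // Frobenius_reciprocity.
exact: ramificationE.
Qed.

Lemma constt_Res_ramification i :
  (t \in irr_constt ('Res[N] 'chi[G]_i)) = (e i != 0)%N.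
Proof. by rewrite irr_consttE cfdot_Res_ramification pnatr_eq0. Qed.

Lemma ramification_Res i :
  (e i != 0)%N ->
  'Res[N] 'chi[G]_i = (e i)%:R *: (\sum_(xi <- ('chi_t ^: G)%CF) xi).
Proof.
rewrite -constt_Res_ramification -cfdot_Res_ramification.
exact: Clifford_Res_sum_cfclass.
Qed.

Lemma sum_cfclass1 :
  (\sum_(xi <- ('chi_t ^: G)%CF) xi) 1%g = n%:R * 'chi_t 1%g.
Proof.
rewrite sum_cfunE big_seq (eq_bigr (fun=> 'chi_t 1%g)) => [|xi]; last first.
  by case/cfclassP=> y _ ->; rewrite cfConjg1.
by rewrite -big_seq big_const_seq count_predT iter_addr_0 mulr_natl.
Qed.

Lemma ramification_irr1 i :
  (e i != 0)%N -> 'chi[G]_i 1%g = (e i * n)%:R * 'chi_t 1%g.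
Proof.
move/ramification_Res=> DRes; rewrite -(cfResE _ (normal_sub nsNG)) //.
by rewrite DRes cfunE sum_cfclass1 mulrA natrM.
Qed.

Lemma cfResInd_ramification :
  'Res[N] ('Ind[G] 'chi_t) =
    (\sum_i e i ^ 2)%:R *: (\sum_(xi <- ('chi_t ^: G)%CF) xi).
Proof.
rewrite {1}['Ind[G] _]cfun_sum_cfdot linear_sum natr_sum scaler_suml.
apply: eq_bigr => i _; rewrite linearZ /= ramificationE.
have [-> | nz_e] := eqVneq (e i) 0%N; first by rewrite !scale0r.
by rewrite ramification_Res // scalerA -natrM.
Qed.

(** Evaluate [cfResInd_ramification] at 1 and cancel ['chi_t 1]. *)
Lemma sum_ramification_sqr : (\sum_i e i ^ 2 * n)%N = #|G : N|%g.
Proof.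
have sNG := normal_sub nsNG.
apply/eqP; rewrite -(eqr_nat algC) -big_distrl natrM /=.
apply/eqP/(mulIf (irr1_neq0 t)); rewrite -mulrA -sum_cfclass1.
rewrite -(cfInd1 _ sNG) -(cfResE _ sNG) //.
by rewrite cfResInd_ramification cfunE.
Qed.

Lemma cfInd_max_ideal (M : {pred algC}) p :
    maximal_Aint_ideal M -> p%:R \in M -> prime p ->
    (p %| #|G : N|%g)%N -> ~~ (p %| n)%N ->
  forall x, 'Ind[G] 'chi_t x \in M.
Proof.
move=> maxM Mp p_pr p_iN p'n x; have [[_ M0 _ MM] _ _] := maxM.
have [Nx | notNx] := boolP (x \in N); last first.
  by rewrite (cfun_on0 (cfInd_normal _ nsNG)).
rewrite -(cfResE _ (normal_sub nsNG)) // cfResInd_ramification cfunE mulrC MM //.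
  rewrite sum_cfunE big_seq rpred_sum // => xi /cfclassP[y Gy ->].
  by rewrite -conjg_IirrE Aint_irr.
rewrite (max_ideal_nat maxM _ p_pr) //; move: p_iN.
by rewrite -sum_ramification_sqr -big_distrl Euclid_dvdM // (negPf p'n) orbF.
Qed.

End Induced.

(** * Counting by sums of squares modulo [p] *)

Lemma dvdn_sum_sqr_coprime (I : finType) (A : {set I}) (e : I -> nat) p :
  prime p -> (p %| \sum_(i in A) e i ^ 2)%N ->
  (p %| \sum_(i in [set i in A | ~~ (p %| e i)]) e i ^ 2)%N.
Proof.
move=> p_pr; rewrite (bigID (fun i => p %| e i)%N) /= dvdn_addr; last first.
  by apply: dvdn_sum => i /andP[_ p_ei]; rewrite Euclid_dvdX // p_ei.
by congr (_ %| _)%N; apply: eq_bigl => i; rewrite inE.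
Qed.

(** A lone square prime to [p] is not 0 mod [p]; modulo 2 or 3 every such square is 1, so the sum is
    the cardinal. *)
Lemma dvdn_sum_sqr_card (I : finType) (A : {set I}) (e : I -> nat) p :
    prime p -> {in A, forall i, ~~ (p %| e i)%N} ->
    (p %| \sum_(i in A) e i ^ 2)%N ->
  (#|A| = 0 \/ 2 <= #|A|)%N /\ (p <= 3 -> p %| #|A|)%N.
Proof.
move=> p_pr p'e p_sum; split=> [|p_le3].
  case DA: #|A| => [|[|m]]; [by left | | by right].
  have /cards1P[i Di]: #|A| == 1%N by rewrite DA.
  have Ai: i \in A by rewrite Di inE.
  by move: p_sum; rewrite Di big_set1 Euclid_dvdX // (negPf (p'e i Ai)).
suffices e2: {in A, forall i, e i ^ 2 = 1 %[mod p]}%N.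
  move: p_sum; rewrite /dvdn -sum1_card -modn_summ (eq_bigr _ e2).
  by rewrite modn_summ.
move=> i /p'e; rewrite /dvdn -modnXm.
case: p p_pr p_le3 {p'e p_sum} => [|[|[|[|p]]]] // _ _.
  by have := ltn_pmod (e i) (isT : 0 < 2)%N; case: (e i %% 2)%N => [|[|]].
by have := ltn_pmod (e i) (isT : 0 < 3)%N; case: (e i %% 3)%N => [|[|[|]]].
Qed.

Lemma dvdn_index_Sylow_quotient (gT : finGroupType) (G P N : {group gT}) p :
    p.-Sylow(G)%g P -> (N <| G)%g -> ((P * N) / N != 1)%g ->
  (p %| #|G : N|%g)%N.
Proof.
case/and3P=> sPG pP _ nsNG; have [sNG nNG] := andP nsNG.
rewrite quotientMidr => ntPN.
have [_ p_PN _] := pgroup_pdiv (quotient_pgroup N pP) ntPN.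
by rewrite -card_quotient // (dvdn_trans p_PN) // cardSg ?quotientS.
Qed.

End RelativeHeightZero.

Theorem theoremB (p : nat) (p_prime : prime p)
    (M : {pred algC}) (maxM : maximal_Aint_ideal M) (pM : (p%:R \in M)%R)
    (gT : finGroupType) (G P : {group gT}) (sylP : p.-Sylow(G)%g P)
    (B : {set Iirr G}) (blB : B \in blocks G M)
    (defB : block_defect_group p M B P)
    (N : {group gT}) (nsNG : (N <| G)%g) (ntPN : ((P * N) / N != 1)%g)
    (t : Iirr N) :
  (k0_above p B t = 0 \/ 2 <= k0_above p B t)
  /\ (p <= 3 -> p %| k0_above p B t).
Proof.
rewrite /k0_above; set A := [set i in B | _ & _].
have [-> | [i0 Ai0]] := set_0Vmem A; first by rewrite cards0; split; [left |].
pose e := @ramification _ G N t; pose n := size (('chi_t)%R ^: G)%CF.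
have [d Dd]: exists d, ('chi_t 1%g = d%:R)%R by apply/natrP/Cnat_irr1.
have De i : e i != 0 -> ('chi_i 1%g = (e i * n * d)%:R)%R.
  by move=> nz_e; rewrite (ramification_irr1 nsNG nz_e) Dd -natrM.
(* The case [e i = 0], where ['chi_i] does not lie above ['chi_t], is covered because [p] divides
   0. *)
have inA i: (i \in A) = (i \in B) && ~~ (p %| e i * n * d).
  rewrite inE constt_Res_ramification -/(e i); congr (_ && _).
  have [-> | nz_e] := eqVneq (e i) 0; first by rewrite dvdn0 andbF.
  by rewrite De // natrK prime_coprime // andbT.
have{i0 Ai0} p'nd: ~~ (p %| n * d).
  by move: Ai0; rewrite inA -mulnA => /andP[_]; apply: contra; apply: dvdn_mull.
have p'n: ~~ (p %| n) by apply: contra p'nd; apply: dvdn_mulr.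
have ->: A = [set i in B | ~~ (p %| e i)].
  by apply/setP=> i; rewrite inA inE -mulnA Euclid_dvdM // (negPf p'nd) orbF.
apply: (@dvdn_sum_sqr_card _ _ e) => //; first by move=> i; rewrite inE => /andP[].
apply: dvdn_sum_sqr_coprime => //.
have p_iN := dvdn_index_Sylow_quotient sylP nsNG ntPN.
have MInd := cfInd_max_ideal nsNG maxM pM p_prime p_iN p'n.
have NInd: ('Ind[G] 'chi_t \is a character)%R by rewrite cfInd_char ?irr_char.
have := block_degree_in maxM blB NInd MInd.
(* One factor [e i] is the multiplicity, the other comes from the degree [e i * n * d]. *)
rewrite (eq_bigr (fun i => (e i ^ 2 * (n * d))%:R)%R) => [|i _]; last first.
  rewrite ramificationE -/(e i).
  have [-> | nz_e] := eqVneq (e i) 0; first by rewrite mul0r.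
  by rewrite De // -natrM -!mulnA.
rewrite -natr_sum (max_ideal_nat maxM _ p_prime) // -big_distrl Euclid_dvdM //=.
by rewrite (negPf p'nd) orbF.
Qed.
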